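(* Let $m,d$ be positive integers and $\pi$ a partition of $m$. Then $H_d(S_m,\chi^{\pi})\neq 0$ if and only if there exists $\alpha\in\Gamma^+_{m,d}$ such that $M(\alpha)\unlhd\pi$.
   Context: $H_d[x_1,\ldots,x_m]$ is the complex vector space of homogeneous polynomials of degree $d$ in commuting variables $x_1,\ldots,x_m$, on which $S_m$ acts by $q^\sigma(x_1,\ldots,x_m)=q(x_{\sigma^{-1}(1)},\ldots,x_{\sigma^{-1}(m)})$. For an irreducible complex character $\chi$ of $S_m$, $H_d(S_m,\chi)$ is the image of $H_d[x_1,\ldots,x_m]$ under the operator $T(S_m,\chi)=\frac{\chi(1)}{m!}\sum_{\sigma\in S_m}\chi(\sigma)\sigma$. $\chi^\pi$ is the irreducible complex character of $S_m$ corresponding to $\pi$. $\Gamma^+_{m,d}$ is the set of $m$-tuples $\alpha=(\alpha_1,\ldots,\alpha_m)$ of non-negative integers with $\sum_i\alpha_i=d$. $M(\alpha)$ is the partition of $m$ formed by arranging in descending order the nonzero multiplicities with which the numbers $0,1,\ldots,d$ occur among $\alpha_1,\ldots,\alpha_m$. For partitions $\lambda,\mu$ of $m$, $\lambda\unlhd\mu$ means $\lambda_1+\cdots+\lambda_i\le\mu_1+\cdots+\mu_i$ for all $i$ (missing parts taken as $0$). *)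

(* Defs.v *)
From HB Require Import structures.
From mathcomp Require Import all_boot all_order all_fingroup all_algebra.
From mathcomp Require Import mxrepresentation.
From mathcomp Require Import complex.
From mathcomp Require Import mpoly.
From mathcomp Require Import reals.

Set Implicit Arguments.
Unset Strict Implicit.
Unset Printing Implicit Defensive.

Import GRing.Theory.
Local Open Scope ring_scope.

Definition is_partition_of (m : nat) (pi : seq nat) : bool :=
  [&& sorted geq pi, 0%N \notin pi & sumn pi == m].

Definition dominated_by (lambda mu : seq nat) : Prop :=
  forall i : nat, (sumn (take i lambda) <= sumn (take i mu))%N.

(* The Young tableau of shape pi is the one with entries 0, 1, ..., m - 1 in
   reading order: entry i is in row [reshape_index pi i] and in column
   [reshape_offset pi i]. *)
Definition row_stab (m : nat) (pi : seq nat) : {set 'S_m} :=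
  [set p : 'S_m | [forall i : 'I_m, reshape_index pi (p i) == reshape_index pi i]].

Definition col_stab (m : nat) (pi : seq nat) : {set 'S_m} :=
  [set q : 'S_m | [forall i : 'I_m, reshape_offset pi (q i) == reshape_offset pi i]].

Section Specht.

Variables (F : fieldType) (m : nat) (pi : seq nat).

Local Notation G := [set: 'S_m]%G.

(* The Young symmetrizer a_pi b_pi = sum_(p, q) sgn(q) (p o q) in F[S_m].
   As products of permutations are composed from left to right,
   p o q is written q * p. *)
Definition young_symmetrizer : 'M[F]_#|G| :=
  \sum_(p in row_stab m pi) \sum_(q in col_stab m pi)
    (-1) ^+ odd_perm q *: regular_repr F G (q * p)%g.

(* The Specht module F[S_m] a_pi b_pi; with the above order of composition, the
   left multiplication x |-> s o x is the right multiplication x |-> x * s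
   of the regular representation. *)
Definition specht_repr :=
  submod_repr
    (cyclic_mx_module (regular_repr F G) (gring_row young_symmetrizer)).

Definition specht_char (s : 'S_m) : F := \tr (specht_repr s).

End Specht.

Section SymmetryClass.

Variables (F : fieldType) (m : nat).

(* q^s (x_1, ..., x_m) = q (x_(s^-1 1), ..., x_(s^-1 m)); [msym s q] substitutes
   'X_(s i) for 'X_i. *)
Definition perm_act (s : 'S_m) (q : {mpoly F[m]}) : {mpoly F[m]} :=
  msym (s^-1)%g q.

Definition symmetrizer (chi : 'S_m -> F) (q : {mpoly F[m]}) : {mpoly F[m]} :=
  (chi 1%g / (m`!)%:R) *: \sum_(s : 'S_m) chi s *: perm_act s q.

Definition symmetry_class (d : nat) (chi : 'S_m -> F) (f : {mpoly F[m]}) :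
    Prop :=
  exists2 q : {mpoly F[m]}, q \is d.-homog & f = symmetrizer chi q.

End SymmetryClass.

Definition mult_partition (m : nat) (alpha : 'X_{1..m}) : seq nat :=
  sort geq [seq k <- [seq #|[set i | alpha i == j]| | j <- iota 0 (mdeg alpha).+1]
           | k != 0%N].

(* Main.v *)
(* Let e be the sum over the stabilizer of alpha in S_m.  The operator T maps
   'X_[alpha] to a nonzero polynomial iff e acts nontrivially on the Specht
   module: the coefficient of 'X_[alpha] is a multiple of the trace of e, which
   is a multiple of its rank.  Let a and b be the row symmetrizer and the column
   antisymmetrizer of the Young tableau, so that the module is generated by b a
   (products being read from left to right).

   If b a g e <> 0 for some g, then b x e <> 0 for some x, hence no transposition
   lies both in the column stabilizer and in the conjugate by x of the stabilizer
   of alpha: alpha \o x is injective on the columns.  Conversely, if alpha \o x is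
   injective on the columns, it can be made increasing down the columns, and then
   x occurs in z = a b x e with a positive coefficient; but b a S_m e = 0 would
   give z^T z = 0, hence z = 0, since z is real.

   Finally a rearrangement of alpha that is injective on the columns exists iff
   the multiplicities of alpha are dominated by pi.  If it exists, make it
   increasing down the columns: its value in row r is then at least r for a
   relabelling of the values in order of decreasing multiplicity.  Conversely,
   start from the filling by row indices and repeatedly change one entry v into w,
   where v occurs more often than w, in a column that contains v but not w. *)
Require Import Defs.
From mathcomp Require Import all_boot all_order all_fingroup all_algebra.
From mathcomp Require Import mxrepresentation complex mpoly reals zify.

Set Implicit Arguments.
Unset Strict Implicit.
Unset Printing Implicit Defensive.

Import Order.TTheory GRing.Theory Num.Theory.

(** * Column-injective fillings of a shape *)

Section Fillings.

Variable m : nat.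
Implicit Types (T M : 'I_m -> nat) (s t x q : 'S_m).

Definition fiber_stab T : {set 'S_m} := 
  [set s : 'S_m | [forall i : 'I_m, T (s i) == T i]].

Lemma fiber_stabP T s : reflect (forall i, T (s i) = T i) (s \in fiber_stab T).
Proof. by rewrite inE; apply: (iffP forallP) => h i; apply/eqP. Qed.

Lemma fiber_stab_group_set T : group_set (fiber_stab T).
Proof.
apply/group_setP; split=> [|s t /fiber_stabP hs /fiber_stabP ht].
  by apply/fiber_stabP => i; rewrite perm1.
by apply/fiber_stabP => i; rewrite permM ht hs.
Qed.

Canonical fiber_stab_group T := Group (fiber_stab_group_set T).

Lemma tperm_fiber_stab T i j : T i = T j -> tperm i j \in fiber_stab T.
Proof. by move=> Tij; apply/fiber_stabP => k; case: tpermP => [->|->|]. Qed.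

(** * Fibre sizes of a filling and their partial sums *)

Definition fiber_size T k := \sum_i (T i == k).
Definition cumul T k := \sum_i (T i < k).

Lemma fiber_sizeE T k : fiber_size T k = #|[set i | T i == k]|.
Proof. by rewrite -sum1dep_card big_mkcond; apply: eq_bigr => i _; case: eqP. Qed.

Lemma cumulE T k : cumul T k = #|[set i | T i < k]|.
Proof. by rewrite -sum1dep_card big_mkcond; apply: eq_bigr => i _; case: ltnP. Qed.

Lemma cumul0 T : cumul T 0 = 0.
Proof. by rewrite /cumul big1. Qed.

Lemma cumulS T k : cumul T k.+1 = cumul T k + fiber_size T k.
Proof.
rewrite /cumul /fiber_size -big_split; apply: eq_bigr => i _ /=.
by rewrite ltnS leq_eqVlt; case: ltngtP.
Qed.

Lemma cumul_sum_fiber_size T k : cumul T k = \sum_(j < k) fiber_size T j.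
Proof.
by elim: k => [|k IHk]; rewrite ?cumul0 ?big_ord0 // cumulS IHk big_ord_recr.
Qed.

Lemma cumul_le T k : cumul T k <= m.
Proof. by rewrite cumulE -[leqRHS]card_ord max_card. Qed.


Lemma cumul_fullP T k : reflect (forall i, T i < k) (cumul T k == m).
Proof.
rewrite cumulE; have := subset_leqif_cards (subsetT [set i | T i < k]).
rewrite cardsT card_ord => -[_ ->]; apply: (iffP eqP) => [h i|h].
  by have := in_setT i; rewrite -h inE.
by apply/setP=> i; rewrite !inE h.
Qed.

Lemma cumul_perm T s k : cumul (T \o s) k = cumul T k.
Proof. by rewrite /cumul [RHS](reindex_inj (@perm_inj _ s)). Qed.

Lemma eq_fiber_size_perm T M : fiber_size T =1 fiber_size M -> exists x, T =1 M \o x.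
Proof.
move=> eqTM; pose tM := [tuple M i | i < m]; pose tT := [tuple T i | i < m].
have: perm_eq tT tM.
  have cE S k : count_mem k [tuple S i | i < m] = fiber_size S k.
    rewrite -sum1_count big_tuple big_mkcond /=.
    by apply: eq_bigr => i _; rewrite tnth_mktuple; case: eqP.
  by apply/allP => k _ /=; rewrite !cE eqTM.
case/tuple_permP => x eqx; exists x => i.
have := congr1 (fun r : seq nat => nth 0 r i) eqx.
by rewrite -!tnth_nth !tnth_mktuple.
Qed.

(** * Cells of a diagram, and fillings with distinct entries in each column *)

Variables row col : 'I_m -> nat.
Hypothesis cell_inj : forall i j, row i = row j -> col i = col j -> i = j.
Hypothesis cell_above :
  forall i r, r < row i -> exists2 j, row j = r & col j = col i.

Definition col_injective T := forall i j, col i = col j -> T i = T j -> i = j.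
Definition col_increasing T :=
  forall i j, col i = col j -> (T i < T j) = (row i < row j).

(** The entries of the column smaller than [T i] are those in the cells above [i], and by
    [cell_above] there is exactly one such cell in each row [r < row i]. Thus an increasing filling
    determines the rows. *)
Lemma row_as_rank T i : col_increasing T ->
  row i = #|[set j | (col j == col i) && (T j < T i)]|.
Proof.
move=> incT; set A := [set _ | _].
have AP j : reflect (col j = col i /\ row j < row i) (j \in A).
  rewrite inE; apply: (iffP andP) => -[cj].
    by move/eqP: cj => cj; rewrite incT.
  by rewrite incT // cj.
(* The successor makes [inord] available even when [row i = 0]; the extra value [ord_max] is the
   only one that [f] misses on [A]. *)
pose f j : 'I_(row i).+1 := inord (row j).
have fE j : j \in A -> f j = row j :> nat.
  by case/AP=> _ h; rewrite inordK // ltnS ltnW.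
have <-: #|f @: A| = #|A|.
  apply: card_in_imset => j k Aj Ak /(congr1 val) /=; rewrite !fE // => h.
  by have [cj _] := AP _ Aj; have [ck _] := AP _ Ak; apply: cell_inj; rewrite ?cj.
suff ->: f @: A = [set~ ord_max] by rewrite cardsC1 card_ord.
apply/setP=> r; rewrite !inE; apply/imsetP/idP => [[j Aj ->]|neq].
  by have [_ rj] := AP _ Aj; rewrite -val_eqE /= fE // neq_ltn rj.
have: r < row i by rewrite ltn_neqAle -ltnS ltn_ord andbT; exact: neq.
move=> ltr; have [j rj cj] := cell_above ltr.
have Aj : j \in A by apply/AP; rewrite rj.
by exists j => //; apply: val_inj; rewrite /= fE.
Qed.

Definition weight T := \sum_i row i * T i.

(** Rearrangement inequality: swapping two entries of a column with [row i < row j] and [T i > T j]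
    would add [(row j - row i) * (T i - T j) > 0] to the weight. Column injectivity excludes
    ties. *)
Lemma weight_max_increasing T : col_injective T ->
    (forall q, q \in fiber_stab col -> weight (T \o q) <= weight T) ->
  col_increasing T.
Proof.
move=> injT maxT.
have mono i j : col i = col j -> row i < row j -> T i < T j.
  move=> cij rij; rewrite ltnNge; apply/negP => leT.
  have neij : i != j by apply: contraTneq rij => ->; rewrite ltnn.
  have ltT : T j < T i.
    by rewrite ltn_neqAle leT andbT; apply: contra_neq neij => /injT ->.
  have := maxT _ (tperm_fiber_stab cij).
  have split2 S : weight S =
      row i * S i + (row j * S j + \sum_(k | (k != i) && (k != j)) row k * S k).
    by rewrite /weight (bigD1 i) // (bigD1 j) //= eq_sym.
  rewrite !split2 /= tpermL tpermR.
  rewrite [X in _ + (_ + X) <= _](eq_bigr (fun k => row k * T k)); first by nia.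
  by move=> k /andP[/negPf ki /negPf kj]; rewrite tpermD // eq_sym ?ki ?kj.
move=> i j cij; apply/idP/idP => [ltT|/mono -> //].
case: ltngtP => // [/(mono _ _ (esym cij))|rij]; first by rewrite ltnNge ltnW.
by rewrite (cell_inj rij cij) ltnn in ltT.
Qed.

Lemma weight_perm T p : p \in fiber_stab row -> weight (T \o p) = weight T.
Proof.
move=> /fiber_stabP hp; rewrite /weight [RHS](reindex_inj (@perm_inj _ p)).
by apply: eq_bigr => i _; rewrite /= hp.
Qed.

Lemma col_injective_perm T q :
  q \in fiber_stab col -> col_injective T -> col_injective (T \o q).
Proof.
move=> /fiber_stabP hq injT i j cij Tij.
by apply: (@perm_inj _ q); apply: injT; rewrite ?hq.
Qed.

Lemma weight_maximizer T : exists2 q0, q0 \in fiber_stab col &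
  forall q, q \in fiber_stab col -> weight (T \o q) <= weight (T \o q0).
Proof.
have [q0 Cq0 max0] := @arg_maxnP _ 1%g (fun q => q \in fiber_stab col)
   (fun q => weight (T \o q)) (group1 _).
by exists q0.
Qed.

(** Both [T] and [T \o q] are maximizers, hence increasing. The rank of [i] for [T \o q] is that of
    [q i] for [T], so [q] preserves rows as well as columns. *)
Lemma weight_maximizer_uniq T q : col_injective T ->
    (forall q', q' \in fiber_stab col -> weight (T \o q') <= weight T) ->
  q \in fiber_stab col -> weight (T \o q) = weight T -> q = 1%g.
Proof.
move=> injT maxT Cq eqw; have incT := weight_max_increasing injT maxT.
have incTq : col_increasing (T \o q).
  apply: weight_max_increasing; first exact: col_injective_perm.
  move=> q' Cq'; rewrite eqw; apply: leq_trans (maxT (q' * q)%g _).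
    by apply: eq_leq; apply: eq_bigr => i _; rewrite /= permM.
  exact: groupM.
have /fiber_stabP hq := Cq.
apply/permP => i; rewrite perm1; apply: cell_inj => //.
rewrite (row_as_rank i incTq) (row_as_rank (q i) incT).
rewrite -[RHS](card_imset _ (@perm_inj _ q)); congr #|pred_of_set _|.
apply/setP=> j; rewrite -[j](permKV q) (mem_imset _ _ (@perm_inj _ q)).
by rewrite !inE /= !hq.
Qed.

(** Once the filling is increasing down the columns, the [row i] cells above [i] carry distinct
    values below that of [i], so this value is at least [row i]: values below [k] occur only in rows
    below [k]. *)
Lemma col_injective_cumul T k : col_injective T -> cumul T k <= cumul row k.
Proof.
move=> injT; have [q Cq maxq] := weight_maximizer T.
rewrite -(cumul_perm T q).
have injTq := col_injective_perm Cq injT.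
have inc : col_increasing (T \o q).
  apply: weight_max_increasing => // q' Cq'.
  apply: leq_trans (maxq (q' * q)%g _); last exact: groupM.
  by apply: eq_leq; apply: eq_bigr => i _; rewrite /= permM.
apply: leq_sum => i _; set S := T \o q in inc injTq *.
suff: row i <= S i by case: (ltnP (row i)); case: ltnP => //; lia.
rewrite (row_as_rank i inc) -[leqRHS]card_ord.
have [->|Si0] := posnP (S i).
  by rewrite card_ord leqn0 cards_eq0; apply/eqP/setP=> j; rewrite !inE andbF.
pose f j : 'I_(S i).-1.+1 := inord (S j).
rewrite -[in leqRHS](prednK Si0) -(@card_in_imset _ _ f) ?max_card //.
move=> j j'; rewrite !inE => /andP[/eqP cj ltj] /andP[/eqP cj' ltj'].
move/(congr1 val); rewrite /= !inordK ?prednK // => eqS.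
by apply: injTq; rewrite ?cj.
Qed.

(** If every column containing [v] also contained [w], sending each cell with value [v] to the cell
    with value [w] in its column would be injective, against the fibre sizes. *)
Lemma recolor_step T v w : col_injective T -> fiber_size T w < fiber_size T v ->
  exists2 i, T i = v & col_injective (fun j => if j == i then w else T j).
Proof.
move=> injT ltwv.
have [i /andP[/eqP Ti /forallP hi]|h] :=
  pickP [pred i | (T i == v) && [forall j, (col j == col i) ==> (T j != w)]].
  have {}hi j : col j = col i -> (T j == w) = false.
    by move=> cj; have := hi j; rewrite cj eqxx => /negPf.
  exists i => // j k cjk; have [ji|ji] := eqVneq j i.
    by case: eqVneq => [->//|_ /esym/eqP]; rewrite hi // -cjk ji.
  by case: eqVneq => [ki|_ /injT->//]; move/eqP; rewrite hi // cjk ki.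
have {}h i : T i = v -> exists j, (col j == col i) && (T j == w).
  move=> Ti; have := h i; rewrite /= Ti eqxx /= => /negbT /forallPn[j].
  by rewrite negb_imply negbK => hj; exists j.
pose f i := odflt i [pick j | (col j == col i) && (T j == w)].
have fP i : T i = v -> col (f i) = col i /\ T (f i) = w.
  move=> /h[j hj]; rewrite /f; case: pickP => [k /andP[/eqP -> /eqP ->] //|/(_ j)].
  by rewrite hj.
move: ltwv; rewrite ltnNge => /negP[]; rewrite !fiber_sizeE.
rewrite -(@card_in_imset _ _ f) => [|i j].
  apply/subset_leq_card/subsetP => _ /imsetP[i /[!inE] /eqP /fP[_ Tf] ->].
  exact/eqP.
rewrite !inE => /eqP Ti /eqP Tj eqf.
by apply: injT; rewrite ?Ti // -(fP i Ti).1 eqf (fP j Tj).1.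
Qed.

Lemma cumul_recolor T i w k : T i < w ->
  cumul (fun j => if j == i then w else T j) k + (T i < k <= w) = cumul T k.
Proof.
move=> ltw; rewrite /cumul (bigD1 i) // [RHS](bigD1 i) //= eqxx.
rewrite [in LHS](eq_bigr (fun j => (T j < k : nat))).
  rewrite addnAC; congr (_ + _).
  by case: (ltnP w k); case: (ltnP (T i) k) => //; lia.
by move=> j /negPf->.
Qed.

(** Take for [v] the first value whose fibre sizes differ, where domination forces an excess of [T],
    and for [w] the first value that is rarer in [T] than in [M]. The excess gained at [v] is not
    lost before [w]. *)
Lemma cumul_dominance_excess T M : (forall k, cumul M k <= cumul T k) ->
    (exists k, fiber_size T k != fiber_size M k) ->
  exists v w, [/\ fiber_size M v < fiber_size T v,
    fiber_size T w < fiber_size M w, v < w &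
    forall k, v < k <= w -> cumul M k < cumul T k].
Proof.
move=> domT neqT; case: (ex_minnP neqT) => v neqv minv.
have eqv k : k < v -> fiber_size T k = fiber_size M k.
  by move=> ltk; apply: contraTeq ltk => /minv; rewrite -leqNgt.
have eqcv : cumul T v = cumul M v.
  by rewrite !cumul_sum_fiber_size; apply: eq_bigr => k _; rewrite eqv.
have ltv : fiber_size M v < fiber_size T v.
  by have := domT v.+1; rewrite !cumulS eqcv leq_add2l leq_eqVlt eq_sym (negPf neqv).
have strict k : v < k -> (forall j, j < k -> fiber_size M j <= fiber_size T j) ->
    cumul M k < cumul T k.
  move=> ltvk leMT; rewrite !cumul_sum_fiber_size (bigD1 (Ordinal ltvk)) //.
  rewrite [ltnRHS](bigD1 (Ordinal ltvk)) //= -addSn.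
  by apply: leq_add => //; apply: leq_sum => j _; apply: leMT.
(* Otherwise the excess at [v] would persist up to a bound [n] on all values of [M], where
   [cumul M n] is already the total [m]. *)
have exw : exists w, fiber_size T w < fiber_size M w.
  pose n := maxn v.+1 (\max_i M i).+1.
  have [[w ltw]|allw] := pickP (fun w : 'I_n => fiber_size T w < fiber_size M w).
    by move=> ltTw; exists w.
  suff: cumul M n < cumul T n.
    suff /eqP-> : cumul M n == m by rewrite ltnNge cumul_le.
    by apply/cumul_fullP => i; rewrite leq_max !ltnS (leq_bigmax i) orbT.
  apply: strict => [|j ltj]; first by rewrite leq_max leqnn.
  by rewrite leqNgt; have /= -> := allw (Ordinal ltj).
case: (ex_minnP exw) => w ltw minw.
have leMT j : j < w -> fiber_size M j <= fiber_size T j.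
  by move=> ltj; rewrite leqNgt; apply: contraTN ltj => /minw; rewrite -leqNgt.
have ltvw : v < w.
  rewrite ltnNge leq_eqVlt; apply/negP => /orP[/eqP eqw|/eqv eqw].
    by move: ltw; rewrite eqw ltnNge ltnW.
  by rewrite eqw ltnn in ltw.
exists v, w; split=> // k /andP[ltvk lekw]; apply: strict => // j ltj.
by apply: leMT; apply: leq_trans lekw.
Qed.

Lemma col_injective_exists M :
    (forall j k, j <= k -> fiber_size M k <= fiber_size M j) ->
    (forall k, cumul M k <= cumul row k) ->
  exists x : 'S_m, col_injective (M \o x).
Proof.
move=> decM domM; pose n := (\max_i M i).+1.
have cumulMn : cumul M n = m.
  by apply/eqP/cumul_fullP => i; rewrite ltnS (leq_bigmax i).
suff [T injT eqT]: exists2 T, col_injective T & fiber_size T =1 fiber_size M.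
  have [x Tx] := eq_fiber_size_perm eqT; exists x => i j cij Mij.
  by apply: injT => //; rewrite !Tx.
have ltn T : (forall k, cumul M k <= cumul T k) -> forall i, T i < n.
  move=> /(_ n); rewrite cumulMn => domT; apply/cumul_fullP.
  by rewrite eqn_leq cumul_le.
have sum_le T : (forall i, T i < n) -> \sum_i T i <= m * n.
  move=> ltTn; rewrite -[m in m * n]card_ord -sum_nat_const.
  by apply: leq_sum => i _; apply: ltnW.
have: col_injective row by move=> i j c r; apply: cell_inj.
(* Each recolouring raises one entry, while domination keeps all entries below [n]; so this measure
   drops. The induction runs over all column-injective fillings that dominate [M], starting from
   [row]. *)
have [N] := ubnP (m * n - \sum_i row i).
move: row domM; clear cell_inj cell_above.
elim: N => // N IHN T domT ltN injT.
have [/forallP eqT|] := boolP [forall k : 'I_n, fiber_size T k == fiber_size M k].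
  exists T => // k; have [ltk|lek] := ltnP k n; first exact/eqP/(eqT (Ordinal ltk)).
  have mult0 S : (forall k, cumul M k <= cumul S k) -> fiber_size S k = 0.
    move=> domS; rewrite /fiber_size big1 // => i _.
    by have := ltn S domS i; case: eqP => // ->; rewrite ltnNge lek.
  by rewrite !mult0.
rewrite negb_forall => /existsP[k neqk].
have [|v [w [ltv ltw ltvw excess]]] := cumul_dominance_excess domT.
  by exists (k : nat).
have [|i Ti injT'] := recolor_step injT (v := v) (w := w).
  (* The fibre sizes satisfy [T] at [w] < [M] at [w] <= [M] at [v] < [T] at [v]; the middle step is
     where [M] must be labelled by decreasing multiplicity. *)
  by apply: leq_trans ltw (leq_trans (decM _ _ (ltnW ltvw)) (ltnW ltv)).
have ltTw : T i < w by rewrite Ti.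
pose T' j := if j == i then w else T j.
have domT' j : cumul M j <= cumul T' j.
  have := cumul_recolor j ltTw; rewrite -/T' Ti => eqT'.
  by case: (boolP (v < j <= w)) eqT' => [/excess|_] ; have := domT j; lia.
have sumT' : \sum_j T' j + v = \sum_j T j + w.
  rewrite (bigD1 i) // [in RHS](bigD1 i) //= /T' eqxx Ti.
  by rewrite [in LHS](eq_bigr T) => [|j /negPf-> //]; lia.
apply: (IHN T') => //; have := sum_le _ (ltn _ domT'); lia.
Qed.

End Fillings.

Local Open Scope ring_scope.

(** * Modules generated by an element of the group algebra *)

(** In a rank factorization [A = K L], cancelling the full-rank factors in [A A = c A] gives
    [L K = c I], and [K L] has the same trace as [L K]. *)
Lemma mxtrace_quasi_idempotent (F : fieldType) n (A : 'M[F]_n) c :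
  A *m A = c *: A -> \tr A = c *+ \rank A.
Proof.
move=> AA; rewrite -[A in LHS]mulmx_base mxtrace_mulC -mxtrace_scalar.
congr (\tr _); apply: (row_free_inj (row_base_free A)).
have inj := row_full_inj (col_base_full A); apply: inj => /=.
rewrite mul_scalar_mx -scalemxAr mulmx_base -AA -[A in RHS]mulmx_base.
by rewrite !mulmxA.
Qed.

(** The diagonal entries of the product are sums of squares; realness prevents these from
    cancelling. *)
Lemma real_trmx_mul_eq0 (F : numFieldType) m n (A : 'M[F]_(m, n)) :
  (forall i j, A i j \is Num.real) -> A^T *m A = 0 -> A = 0.
Proof.
move=> realA AA; apply/matrixP => i j; rewrite mxE; apply/eqP.
have /matrixP/(_ j j) := AA; rewrite !mxE.
rewrite (eq_bigr (fun k => A k j ^+ 2)) => [|k _]; last by rewrite mxE.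
move=> /psumr_eq0P/(_ i isT)/eqP; rewrite sqrf_eq0; apply.
by move=> k _; rewrite -realEsqr.
Qed.

Section SubgroupSum.

Variables (F : fieldType) (gT : finGroupType) (G : {group gT}) (n : nat).
Variables (rG : mx_representation F G n) (H : {group gT}).
Hypothesis sHG : H \subset G.

Definition subgroup_sum := \sum_(h in H) rG h.

Lemma repr_mul_subgroup_sum h : h \in H -> rG h *m subgroup_sum = subgroup_sum.
Proof.
move=> Hh; rewrite mulmx_sumr [RHS](reindex_inj (mulgI h)) /=.
apply: eq_big => [k|k Hk]; first by rewrite groupMl.
by rewrite repr_mxM // (subsetP sHG).
Qed.

Lemma subgroup_sum_sqr : subgroup_sum *m subgroup_sum = #|H|%:R *: subgroup_sum.
Proof.
rewrite {1}/subgroup_sum mulmx_suml (eq_bigr (fun=> subgroup_sum)).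
  by rewrite sumr_const scaler_nat.
exact: repr_mul_subgroup_sum.
Qed.

End SubgroupSum.

Section RegularModule.

Variables (F : fieldType) (gT : finGroupType) (G : {group gT}).
Local Notation aG := (regular_repr F G).

Lemma regular_reprE g i j :
  aG g i j = (j == gring_index G (enum_val i * g)%g)%:R.
Proof. by rewrite !mxE eqxx. Qed.

(** Transposition thus realizes the anti-involution of the group algebra that inverts group
    elements. *)
Lemma trmx_regular_repr g : g \in G -> (aG g)^T = aG g^-1%g.
Proof.
move=> Gg; apply/matrixP => i j; rewrite mxE !regular_reprE; congr (_%:R).
have key (k l : 'I_#|G|) h : h \in G -> (l == gring_index G (enum_val k * h)%g) =
    (enum_val l == enum_val k * h)%g.
  move=> Gh; rewrite -(inj_eq (can_inj gring_valK)) gring_indexK //.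
  by rewrite groupM ?enum_valP.
by rewrite !key ?groupV // eq_sym (canF_eq (mulgK _)).
Qed.

Variables (Y : 'M[F]_#|G|) (H : {group gT}).
Hypotheses (GY : (Y \in group_ring F G)%MS) (sHG : H \subset G).

Let V := cyclic_mx aG (gring_row Y).
Let rV := submod_repr (cyclic_mx_module aG (gring_row Y)).

(** The sum acts on the module [V] as right multiplication by [Q]. Through [gring_row], the rows of
    [V] are products [Y a] with [a] in the group algebra, and by linearity it suffices to test [a]
    in [G]. *)
Lemma cyclic_subgroup_sum_eq0 :
  subgroup_sum rV H = 0 <->
  forall g, g \in G -> Y *m aG g *m subgroup_sum aG H = 0.
Proof.
set Q := subgroup_sum aG H.
have GQ : (Q \in group_ring F G)%MS.
  rewrite /Q /subgroup_sum linear_sum summx_sub // => h Hh.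
  by rewrite envelop_mx_id // (subsetP sHG).
have valQ : val_submod (subgroup_sum rV H) = val_submod 1%:M *m Q.
  rewrite /subgroup_sum linear_sum mulmx_sumr; apply: eq_bigr => h Hh.
  by rewrite -(val_submodJ (cyclic_mx_module aG _)) ?(subsetP sHG) // mul1mx.
have -> : subgroup_sum rV H = 0 <-> V *m Q = 0.
  have eqV := eqmxMr Q (val_submod1 V).
  split=> [sum0|VQ0].
    by apply/eqP; rewrite -mxrank_eq0 -eqV -valQ sum0 linear0 mxrank0.
  by apply/eqP; rewrite -val_submod_eq0 valQ -mxrank_eq0 eqV VQ0 mxrank0.
split=> [VQ0 g Gg|YQ0].
  rewrite -[LHS]gring_rowK; last by rewrite !envelop_mxM ?envelop_mx_id.
  rewrite !gring_row_mul; have: (gring_row Y *m aG g <= V)%MS.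
    by apply/cyclic_mxP; exists (aG g); rewrite ?envelop_mx_id.
  by case/submxP => D ->; rewrite -mulmxA VQ0 mulmx0 linear0.
apply/row_matrixP => i; rewrite row_mul row0.
have /cyclic_mxP[A /envelop_mxP[a ->] ->] := row_sub i V.
rewrite -gring_row_mul -gring_row_mul [Y *m _]mulmx_sumr mulmx_suml.
rewrite big1 ?linear0 // => g Gg.
by rewrite -scalemxAr -scalemxAl YQ0 ?scaler0.
Qed.

End RegularModule.

(** * The Young symmetrizer *)

Section YoungSymmetrizer.

Variables (F : numFieldType) (m : nat) (row col : 'I_m -> nat).
Hypothesis cell_inj : forall i j, row i = row j -> col i = col j -> i = j.
Hypothesis cell_above :
  forall i r, (r < row i)%N -> exists2 j, row j = r & col j = col i.

Local Notation G := [set: 'S_m]%G.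
Local Notation aG := (regular_repr F G).
Local Notation R := (fiber_stab row).
Local Notation C := (fiber_stab col).
Local Notation S T := (subgroup_sum aG (fiber_stab_group T)).

Definition col_antisymmetrizer : 'M[F]_#|G| :=
  \sum_(q in C) (-1) ^+ odd_perm q *: aG q.
Local Notation B := col_antisymmetrizer.
Local Notation P := (S row).

Lemma regular_reprM (s t : 'S_m) : aG (s * t)%g = aG s *m aG t.
Proof. by rewrite repr_mxM ?inE. Qed.

Lemma col_antisymmetrizer_tperm i j : i != j -> col i = col j ->
  B *m aG (tperm i j) = - B.
Proof.
move=> neij /tperm_fiber_stab Ct; rewrite mulmx_suml -sumrN.
rewrite [RHS](reindex_inj (mulIg (tperm i j))) /=.
apply: eq_big => [q|q Cq]; first by rewrite groupMr.
rewrite odd_permM odd_tperm neij addbT signrN scaleNr opprK.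
by rewrite -scalemxAl regular_reprM.
Qed.

(** If [i] and [j] violated injectivity, the transposition of [x i] and [x j] would be absorbed by
    the sum on the right, and moved past [x] it becomes [tperm i j], which negates [B]: the product
    would equal its opposite. *)
Lemma antisymmetrizer_neq0 T (x : 'S_m) :
  B *m aG x *m S T != 0 -> col_injective col (T \o x).
Proof.
move=> nz i j cij /= Tij; apply: contraNeq nz => neij.
set Z := _ *m S T; have eqZ : Z = - Z.
  have Tt : (tperm i j ^ x)%g \in fiber_stab T.
    by rewrite tpermJ tperm_fiber_stab.
  rewrite {1}/Z -(repr_mul_subgroup_sum aG _ Tt) ?subsetT //.
  rewrite mulmxA -(mulmxA B) -regular_reprM conjgE mulKVg regular_reprM mulmxA.
  by rewrite col_antisymmetrizer_tperm // !mulNmx.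
have: 2%:R *: Z = 0 by rewrite scaler_nat mulr2n {1}eqZ addNr.
by move/eqP; rewrite scaler_eq0 pnatr_eq0.
Qed.

Lemma symmetrizer_neq0 T (x : 'S_m) :
  B *m P *m aG x *m S T != 0 -> exists y : 'S_m, col_injective col (T \o y).
Proof.
move=> nz; have [p nzp|all0] := pickP (fun p => B *m aG (p * x)%g *m S T != 0).
  by exists (p * x)%g; apply: antisymmetrizer_neq0.
case/eqP: nz; rewrite -2!mulmxA [P *m _]mulmx_suml mulmx_sumr big1 // => p _.
by have /negbFE/eqP := all0 p; rewrite regular_reprM -!mulmxA.
Qed.

Lemma trmx_stab_sum T : (S T)^T = S T.
Proof.
rewrite /subgroup_sum linear_sum [RHS](reindex_inj invg_inj) /=.
by apply: eq_big => [s|s _]; rewrite ?groupV ?trmx_regular_repr ?inE.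
Qed.

Lemma trmx_col_antisymmetrizer : B^T = B.
Proof.
rewrite /B linear_sum [RHS](reindex_inj invg_inj) /=.
apply: eq_big => [s|s _]; first by rewrite groupV.
by rewrite linearZ /= trmx_regular_repr ?inE // odd_permV.
Qed.

Lemma rev_symmetrizer_real_entries T x i j :
  (P *m B *m aG x *m S T) i j \is Num.real.
Proof.
have realS U k l : (S U) k l \is Num.real.
  by rewrite summxE rpred_sum // => s _; rewrite regular_reprE realn.
have mulmx_real (U V : 'M[F]_#|G|) : (forall k l, U k l \is Num.real) ->
    (forall k l, V k l \is Num.real) -> forall k l, (U *m V) k l \is Num.real.
  by move=> hU hV k l; rewrite mxE rpred_sum // => s _; rewrite realM.
have realG k l : aG x k l \is Num.real by rewrite regular_reprE realn.
apply: (mulmx_real _ _ (mulmx_real _ _ _ realG) (realS _)) => {i j}.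
apply: (mulmx_real _ _ (realS _)) => k l; rewrite summxE rpred_sum // => s _.
by rewrite mxE regular_reprE rpredM ?realn // rpredX // rpredN rpred1.
Qed.

Lemma rev_symmetrizer_expansion T x : P *m B *m aG x *m S T =
  \sum_(p in R) \sum_(q in C) \sum_(s in fiber_stab T)
    (-1) ^+ odd_perm q *: aG (p * q * x * s)%g.
Proof.
rewrite /subgroup_sum !mulmx_suml; apply: eq_bigr => p _.
rewrite [_ *m B]mulmx_sumr !mulmx_suml; apply: eq_bigr => q _.
rewrite mulmx_sumr; apply: eq_bigr => s _.
by rewrite -scalemxAr -!scalemxAl !regular_reprM.
Qed.

(* The coefficient of [x] in this element of the group algebra is positive: by
   the uniqueness of the maximizer of the weight, only [q = 1] contributes. *)
Lemma rev_symmetrizer_neq0 T (x : 'S_m) : col_injective col (T \o x) ->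
    (forall q, q \in C -> (weight row (T \o x \o q) <= weight row (T \o x))%N) ->
  P *m B *m aG x *m S T != 0.
Proof.
move=> injT maxT; apply/eqP => Z0.
pose c p q s : F := (-1) ^+ odd_perm q * (x == p * q * x * s)%g%:R.
have cE p q s : p \in R -> q \in C -> s \in fiber_stab T ->
    c p q s = ((q == 1) && (x == p * x * s))%g%:R.
  move=> Rp Cq /fiber_stabP Ts; rewrite /c.
  have [->|q1] := eqVneq q 1%g; first by rewrite odd_perm1 mul1r mulg1.
  case: eqP => [xE|]; last by rewrite mulr0.
  (* As [s] fixes [T], the equation [x = p * q * x * s] identifies [T \o x] with [T \o x \o q \o p].
     Since [p] preserves rows, [q] attains the maximal weight. *)
  case/eqP: q1; apply: (weight_maximizer_uniq cell_inj cell_above injT) => //.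
  rewrite -(weight_perm _ Rp); apply: eq_bigr => i _ /=.
  by congr (_ * _)%N; rewrite [in RHS]xE !permM Ts.
have c_ge0 p q s : p \in R -> q \in C -> s \in fiber_stab T -> 0 <= c p q s.
  by move=> *; rewrite cE // ler0n.
have coefx g : aG g (gring_index G 1%g) (gring_index G x) = (x == g)%:R.
  rewrite regular_reprE gring_indexK ?inE // mul1g.
  by rewrite -(inj_eq (can_inj gring_valK)) !gring_indexK ?inE.
have: \sum_(p in R) \sum_(q in C) \sum_(s in fiber_stab T) c p q s = 0.
  have := congr1 (fun A : 'M_#|G| => A (gring_index G 1%g) (gring_index G x)) Z0.
  rewrite rev_symmetrizer_expansion mxE summxE => Zx; rewrite -[RHS]Zx.
  apply: eq_bigr => p _; rewrite summxE; apply: eq_bigr => q _.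
  by rewrite summxE; apply: eq_bigr => s _; rewrite mxE coefx.
have R1 : 1%g \in R by exact: (group1 (fiber_stab_group row)).
have C1 : 1%g \in C by exact: (group1 (fiber_stab_group col)).
have T1 : 1%g \in fiber_stab T by exact: (group1 (fiber_stab_group T)).
move=> /psumr_eq0P/(_ 1%g R1) c0; suff: c 1%g 1%g 1%g = 0.
  by move/eqP; rewrite cE // eqxx mul1g mulg1 eqxx oner_eq0.
apply: (psumr_eq0P _ (psumr_eq0P _ (c0 _) C1)) => //.
- by move=> s Ts; apply: c_ge0.
- by move=> q Cq; apply: sumr_ge0 => s Ts; apply: c_ge0.
- by move=> p Rp; apply: sumr_ge0 => q Cq; apply: sumr_ge0 => s Ts; apply: c_ge0.
Qed.

(* If [b a g e = 0] for all [g], with [a = a^*], [b = b^*], [e = e^*] and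
   [a^2 = |R| a], then [z = a b x e] satisfies [z^* z = |R| e x^-1 b a b x e = 0]. *)
Lemma rev_symmetrizer_eq0 T (x : 'S_m) :
  (forall g : 'S_m, B *m P *m aG g *m S T = 0) -> P *m B *m aG x *m S T = 0.
Proof.
move=> BP0; apply: real_trmx_mul_eq0; first exact: rev_symmetrizer_real_entries.
set z := _ *m S T.
have PBP0 : B *m z = 0.
  rewrite /z -!mulmxA; set e := aG x *m S T.
  rewrite [B *m e]mulmx_suml !mulmx_sumr big1 // => q _.
  rewrite -!scalemxAl -!scalemxAr /e (mulmxA (aG q)) -regular_reprM.
  by rewrite !mulmxA BP0 scaler0.
have zE : z^T = (B *m aG x *m S T)^T *m P.
  by rewrite /z -!mulmxA trmx_mul trmx_stab_sum.
have Pz : P *m z = #|R|%:R *: z.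
  by rewrite /z !mulmxA subgroup_sum_sqr ?subsetT // -!scalemxAl.
rewrite zE -mulmxA Pz -scalemxAr -!mulmxA trmx_mul trmx_col_antisymmetrizer.
by rewrite -mulmxA PBP0 mulmx0 scaler0.
Qed.

(** For the converse, a column permutation [q] of maximal weight turns [y] into [x = q * y], which
    meets the hypotheses of [rev_symmetrizer_neq0]. *)
Lemma symmetrizer_neq0P T :
  (exists g : 'S_m, B *m P *m aG g *m S T != 0) <->
  (exists x : 'S_m, col_injective col (T \o x)).
Proof.
split=> [[g]|[y injTy]]; first exact: symmetrizer_neq0.
have [q Cq maxq] := weight_maximizer row col (T \o y).
pose x := (q * y)%g.
have injTx : col_injective col (T \o x).
  move=> i j cij; rewrite /= !permM => Tij.
  exact: (col_injective_perm Cq injTy).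
have [g|BP0] := pickP (fun g => B *m P *m aG g *m S T != 0); first by exists g.
have: P *m B *m aG x *m S T != 0.
  apply: rev_symmetrizer_neq0 => // q' Cq'.
  have := maxq (q' * q)%g (groupM Cq' Cq).
  suff eqw (p : 'S_m) : weight row (T \o x \o p) = weight row (T \o y \o (p * q)%g).
    rewrite eqw => /leq_trans; apply; apply: eq_leq.
    by apply: eq_bigr => i _; rewrite /= permM.
  by apply: eq_bigr => i _; rewrite /= !permM.
by rewrite rev_symmetrizer_eq0 ?eqxx // => g; have /negbFE/eqP := BP0 g.
Qed.

End YoungSymmetrizer.

(** * Partitions and multiplicities *)

Section Partitions.

Local Open Scope nat_scope.

Lemma sorted_geq_nth (s : seq nat) j k :
  sorted geq s -> j <= k -> nth 0 s k <= nth 0 s j.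
Proof.
move=> sorted_s lejk; have [ltk|lek] := ltnP k (size s); last first.
  by rewrite nth_default.
have geq_trans : transitive geq by move=> y x z /= hyx hzy; apply: leq_trans hyx.
have ltj := leq_ltn_trans lejk ltk.
by apply: (sorted_leq_nth geq_trans (leqnn : reflexive geq) 0 sorted_s).
Qed.

Lemma sumn_take_sum (s : seq nat) k : sumn (take k s) = \sum_(j < k) nth 0 s j.
Proof.
elim: k => [|k IHk]; first by rewrite take0 big_ord0.
rewrite big_ord_recr /= -IHk; have [ltk|lek] := ltnP k (size s).
  by rewrite (take_nth 0) // sumn_rcons.
by rewrite nth_default // addn0 !take_oversize // (leq_trans lek).
Qed.

Lemma leq_sumn_take (s : seq nat) j k : j <= k -> sumn (take j s) <= sumn (take k s).
Proof.
move=> lejk; rewrite -(cat_take_drop j (take k s)) take_takel //.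
by rewrite sumn_cat leq_addr.
Qed.

Lemma reshape_index_lt (s : seq nat) i k :
  i < sumn s -> (reshape_index s i < k) = (i < sumn (take k s)).
Proof.
move=> lti; have eqi := reshape_indexK s i; have ltc := reshape_offsetP lti.
have ltr := reshape_indexP lti; rewrite /flatten_index in eqi.
apply/idP/idP => [/(leq_sumn_take s)|]; last apply: contraTT; last first.
  rewrite -!leqNgt => /(leq_sumn_take s) /leq_trans; apply.
  by rewrite -[leqRHS]eqi leq_addr.
apply: leq_trans; rewrite (take_nth 0) // sumn_rcons.
by rewrite -[in X in X < _]eqi ltn_add2l.
Qed.

Variables (m : nat) (pi : seq nat).
Hypothesis pi_part : is_partition_of m pi.

Definition tab_row (i : 'I_m) : nat := reshape_index pi i.
Definition tab_col (i : 'I_m) : nat := reshape_offset pi i.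

Lemma ltn_sumn_partition (i : 'I_m) : i < sumn pi.
Proof. by case/and3P: pi_part => _ _ /eqP->. Qed.

Lemma tab_inj i j : tab_row i = tab_row j -> tab_col i = tab_col j -> i = j.
Proof.
move=> eqr eqc; apply: val_inj; rewrite /= -(reshape_indexK pi i).
by rewrite -(reshape_indexK pi j) -/(tab_row i) -/(tab_col i) eqr eqc.
Qed.

(** As the parts decrease, the column of [i] still fits in the earlier row [r]. *)
Lemma tab_above i r :
  r < tab_row i -> exists2 j, tab_row j = r & tab_col j = tab_col i.
Proof.
move=> ltr; case/and3P: (pi_part) => sorted_pi _ /eqP sum_pi.
have ltc : tab_col i < nth 0 pi r.
  apply: leq_trans (reshape_offsetP (ltn_sumn_partition i)) _.
  exact: sorted_geq_nth (ltnW ltr).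
have ltj : flatten_index pi r (tab_col i) < m by rewrite -sum_pi flatten_indexP.
exists (Ordinal ltj); first exact: flatten_indexKl.
exact: flatten_indexKr.
Qed.

Lemma cumul_tab_row k : cumul tab_row k = sumn (take k pi).
Proof.
have lek : sumn (take k pi) <= m.
  case/and3P: pi_part => _ _ /eqP <-.
  by rewrite -[in leqRHS](cat_take_drop k pi) sumn_cat leq_addr.
rewrite -[RHS]card_ord -sum1_card (big_ord_widen _ (fun=> 1) lek) big_mkcond.
by apply: eq_bigr => i _; rewrite reshape_index_lt ?ltn_sumn_partition.
Qed.

(** List the values of [alpha] by decreasing multiplicity and relabel each value by its position in
    the list [L]. Labels beyond the list have empty fibres, which agrees with the default [0] of
    [nth]. *)
Lemma mult_partition_labels (alpha : 'X_{1..m}) : exists M : 'I_m -> nat,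
  (forall i j, (M i == M j) = (alpha i == alpha j)) /\
  (forall k, fiber_size M k = nth 0 (mult_partition alpha) k).
Proof.
pose cnt v := #|[set i | alpha i == v]|.
pose L := sort (relpre cnt geq) [seq v <- iota 0 (mdeg alpha).+1 | cnt v != 0].
have partE : mult_partition alpha = [seq cnt v | v <- L].
  by rewrite /mult_partition filter_map sort_map.
have uniqL : uniq L by rewrite sort_uniq filter_uniq ?iota_uniq.
have inL i : alpha i \in L.
  rewrite mem_sort mem_filter mem_iota /= ltnS mdegE (bigD1 i) // leq_addr andbT.
  by rewrite cards_eq0; apply/set0Pn; exists i; rewrite inE.
exists (fun i => index (alpha i) L); split=> [i j|k].
  by apply/eqP/eqP => [/(congr1 (nth 0 L))|-> //]; rewrite !nth_index.
rewrite fiber_sizeE partE; have [ltk|lek] := ltnP k (size L).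
  rewrite (nth_map 0) //; congr #|pred_of_set _|; apply/setP=> i; rewrite !inE.
  apply/eqP/eqP => [<-|->]; first by rewrite nth_index.
  by rewrite index_uniq.
rewrite nth_default ?size_map //; apply/eqP; rewrite cards_eq0.
apply/eqP/setP=> i; rewrite !inE; apply/negbTE.
by rewrite neq_ltn (leq_trans _ lek) // index_mem.
Qed.

Lemma dominated_byP (alpha : 'X_{1..m}) :
  dominated_by (mult_partition alpha) pi <->
  exists x : 'S_m, col_injective tab_col (alpha \o x).
Proof.
have [M [eqM multM]] := mult_partition_labels alpha.
have cumulM k : cumul M k = sumn (take k (mult_partition alpha)).
  by rewrite cumul_sum_fiber_size sumn_take_sum; apply: eq_bigr => j _.
have injM (x : 'S_m) :
    col_injective tab_col (alpha \o x) <-> col_injective tab_col (M \o x).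
  by split=> inj i j cij /eqP /= h; apply: inj => //=; apply/eqP;
     rewrite ?eqM // -eqM.
split=> [dom|[x /injM injx] k].
  have [||x /injM] := col_injective_exists tab_inj (M := M); last by exists x.
    move=> j k lejk; rewrite !multM; apply: sorted_geq_nth => //.
    by apply: sort_sorted => a b; apply: leq_total.
  by move=> k; rewrite cumulM cumul_tab_row.
rewrite -cumulM -cumul_tab_row -(cumul_perm M x).
exact: (col_injective_cumul tab_inj tab_above _ injx).
Qed.

End Partitions.

(** * Symmetrized monomials and sums over stabilizers *)

Section SymmetryClassOfRepr.

Variables (F : numFieldType) (m n : nat).
Variable rG : mx_representation F [set: 'S_m]%G n.
Let chi (s : 'S_m) : F := \tr (rG s).

Lemma perm_actX (s : 'S_m) (alpha : 'X_{1..m}) :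
  perm_act s 'X_[alpha] = 'X_[[multinom alpha (s i) | i < m]] :> {mpoly F[m]}.
Proof. by rewrite /perm_act msymX invgK. Qed.

(** The coefficient of ['X_[alpha]] in its own image is [n / m!] times the trace of [E], which is
    [#|H|] times its rank. Conversely, grouping the sum by cosets of [H] makes each coefficient a
    trace of some [rG s *m E]. *)
Lemma symmetrizerX_eq0 (alpha : 'X_{1..m}) :
  symmetrizer chi 'X_[alpha] = 0 <->
  subgroup_sum rG (fiber_stab_group alpha) = 0.
Proof.
set H := fiber_stab_group alpha; set E := subgroup_sum rG H; split=> [sym0|E0].
  have EE : E *m E = #|H|%:R *: E by apply: subgroup_sum_sqr; apply: subsetT.
  have trE : \sum_(s in H) chi s = \tr E by rewrite /E /subgroup_sum linear_sum.
  have: (symmetrizer chi 'X_[alpha])@_alpha = 0 by rewrite sym0 mcoeff0.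
  rewrite /symmetrizer mcoeffZ linear_sum /=.
  rewrite (eq_bigr (fun s => if s \in H then chi s else 0)) => [|s _]; last first.
    rewrite mcoeffZ perm_actX mcoeffX.
    have -> : (s \in H) = ([multinom alpha (s i) | i < m] == alpha).
      apply/fiber_stabP/eqP => [Hs|/mnmP eqs i].
        by apply/mnmP => i; rewrite mnmE.
      by have := eqs i; rewrite mnmE.
    by case: eqP; rewrite ?mulr1 ?mulr0.
  rewrite -big_mkcond trE (mxtrace_quasi_idempotent EE) /chi repr_mx1 mxtrace1.
  move/eqP; rewrite -[_ *+ \rank _]mulr_natr !mulf_eq0 invr_eq0 !pnatr_eq0.
  rewrite [m`! == 0%N]eqn0Ngt fact_gt0 (negPf (lt0n_neq0 (cardG_gt0 H))) orbF /=.
  (* Either the rank is zero or [n = 0], and the rank is at most [n]. *)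
  move=> n0; apply/eqP.
  rewrite -mxrank_eq0 -leqn0; case/orP: n0 => /eqP <- //; exact: rank_leq_row.
rewrite /symmetrizer; suff -> : \sum_s chi s *: perm_act s 'X_[alpha] = 0.
  by rewrite scaler0.
have permH s h : h \in H -> perm_act (s * h)%g 'X_[alpha] =
    perm_act s 'X_[alpha] :> {mpoly F[m]}.
  move=> /fiber_stabP Hh; rewrite !perm_actX; congr 'X_[_].
  by apply/mnmP => i; rewrite !mnmE permM Hh.
apply/eqP; have: #|H|%:R *: \sum_s chi s *: perm_act s 'X_[alpha] =
    0 :> {mpoly F[m]}.
  rewrite scaler_nat -sumr_const.
  (* Replacing [s] by [s * h] leaves the monomial unchanged, so only the character gets averaged
     over [H]. *)
  transitivity (\sum_(h in H) \sum_s chi (s * h)%g *: perm_act s 'X_[alpha]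
    : {mpoly F[m]}).
    apply: eq_bigr => h Hh; rewrite (reindex_inj (mulIg h)) /=.
    by apply: eq_bigr => s _; rewrite permH.
  rewrite exchange_big big1 // => s _; rewrite -scaler_suml.
  have -> : \sum_(h in H) chi (s * h)%g = \tr (rG s *m E).
    rewrite mulmx_sumr linear_sum; apply: eq_bigr => h _.
    by rewrite /chi repr_mxM ?inE.
  by rewrite E0 mulmx0 mxtrace0 scale0r.
by move/eqP; rewrite scaler_eq0 pnatr_eq0 eqn0Ngt cardG_gt0.
Qed.

Lemma symmetry_class_neq0 d :
  (exists2 f : {mpoly F[m]}, symmetry_class d chi f & f != 0) <->
  (exists2 alpha : 'X_{1..m}, mdeg alpha = d &
     subgroup_sum rG (fiber_stab_group alpha) != 0).
Proof.
split=> [[f [q homq ->] nz]|[alpha degalpha nz]]; last first.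
  exists (symmetrizer chi 'X_[alpha]).
    by exists 'X_[alpha] => //; rewrite dhomogX; apply/eqP.
  by apply: contraNneq nz => /symmetrizerX_eq0 ->.
have symq : symmetrizer chi q =
    \sum_(alpha <- msupp q) q@_alpha *: symmetrizer chi 'X_[alpha].
  have actq s : perm_act s q =
      \sum_(alpha <- msupp q) q@_alpha *: perm_act s 'X_[alpha].
    rewrite {1}[q]mpolyE /perm_act raddf_sum.
    by apply: eq_bigr => alpha _; rewrite /= msymZ.
  rewrite /symmetrizer; under eq_bigr => s _ do rewrite actq scaler_sumr.
  rewrite exchange_big scaler_sumr; apply: eq_bigr => alpha _ /=.
  rewrite [RHS]scalerA [q@_alpha * _]mulrC -[RHS]scalerA; congr (_ *: _).
  rewrite [RHS]scaler_sumr; apply: eq_bigr => s _.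
  by rewrite !scalerA mulrC.
have [/hasP[alpha qalpha nzalpha]|/hasPn all0] :=
  boolP (has (fun alpha => symmetrizer chi 'X_[alpha] != 0) (msupp q)).
  exists alpha; first exact: (dhomog_mf homq).
  by apply: contraNneq nzalpha => /symmetrizerX_eq0 ->.
case/eqP: nz; rewrite symq big_seq big1 // => alpha /all0.
by rewrite negbK => /eqP->; rewrite scaler0.
Qed.

End SymmetryClassOfRepr.

(** * Application to the Specht module *)

Lemma young_symmetrizerE (F : numFieldType) m pi :
  young_symmetrizer F m pi = col_antisymmetrizer F (tab_col pi) *m
    subgroup_sum (regular_repr F [set: 'S_m]%G) (fiber_stab_group (tab_row pi)).
Proof.
rewrite /young_symmetrizer exchange_big mulmx_suml; apply: eq_bigr => q _.
rewrite mulmx_sumr; apply: eq_bigr => p _.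
by rewrite -scalemxAl repr_mxM ?inE.
Qed.

Lemma young_symmetrizer_envelop (F : fieldType) m pi :
  (young_symmetrizer F m pi \in group_ring F [set: 'S_m]%G)%MS.
Proof.
rewrite /young_symmetrizer linear_sum summx_sub // => p _.
rewrite linear_sum summx_sub // => q _.
by rewrite linearZ scalemx_sub // envelop_mx_id ?inE.
Qed.

Local Open Scope complex_scope.

Theorem theoremC (R : realType) (m d : nat) (pi : seq nat)
    (hm : (0 < m)%N) (hd : (0 < d)%N) (hpi : is_partition_of m pi) :
  (exists2 f : {mpoly R[i][m]},
      symmetry_class d (@specht_char R[i] m pi) f & f != 0) <->
  (exists2 alpha : 'X_{1..m},
      mdeg alpha = d & dominated_by (mult_partition alpha) pi).
Proof.
apply: iff_trans (symmetry_class_neq0 (specht_repr R[i] m pi) d) _.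
(* The degree condition is the same on both sides, so the equivalence is proved for each exponent
   separately. *)
suff key (alpha : 'X_{1..m}) :
    subgroup_sum (specht_repr R[i] m pi) (fiber_stab_group alpha) != 0 <->
    dominated_by (mult_partition alpha) pi.
  by split=> -[alpha ? /key ?]; exists alpha.
apply: iff_trans _ (iff_sym (dominated_byP hpi alpha)).
apply: iff_trans _
  (symmetrizer_neq0P R[i] (tab_inj (pi := pi)) (tab_above hpi) alpha).
have sum0 := cyclic_subgroup_sum_eq0 (young_symmetrizer_envelop R[i] m pi)
  (subsetT (fiber_stab_group alpha)).
rewrite -young_symmetrizerE; split=> [nz|[g nz]].
  have [g nzg|all0] := pickP (fun g => young_symmetrizer R[i] m pi *m
    regular_repr _ _ g *m
    subgroup_sum (regular_repr _ _) (fiber_stab_group alpha) != 0).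
    by exists g.
  by case/eqP: nz; apply/sum0 => g _; have /negbFE/eqP := all0 g.
by apply: contraNneq nz => /sum0 ->; rewrite ?inE.
Qed.
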